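(* For any $t\in\mathbb{N}$ there exists a positive integer $n(t)$ such that the prime difference graph $G_{n(t)}$ contains $t$ pairwise edge-disjoint Hamilton cycles.
   Context: For a positive integer $n$, the prime difference graph $G_n$ of order $n$ is the graph with vertex set $\{1,2,\dots,n\}$ in which two vertices $u,v$ are adjacent if and only if $|u-v|$ is a prime number. A Hamilton cycle is a cycle visiting each vertex of the graph exactly once. Hamilton cycles are edge-disjoint if no two of them share an edge. *)

(* Defs.v *)
From mathcomp Require Import all_boot all_algebra.

Set Implicit Arguments.
Unset Strict Implicit.
Unset Printing Implicit Defensive.

Section Hamilton.

Variables (T : finType) (e : rel T).

(* A cycle of a simple graph has at least three vertices; the lower bound
   excludes the degenerate closed walk going back and forth along one edge. *)
Definition hamilton_cycle (c : seq T) : bool :=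
  [&& 2 < size c, ucycleb e c & [forall x, x \in c]].

(* Undirected edges, as two-element sets. The function [next c] is cyclic, so
   the edge joining the last vertex to the first one is included. *)
Definition cycle_edges (c : seq T) : {set {set T}} :=
  [set [set x; next c x] | x in c].

End Hamilton.

(* The vertices 1, ..., n are encoded by 'I_n, and i : 'I_n stands for the
   integer i + 1. *)
Definition vertex_label (n : nat) (i : 'I_n) : nat := i.+1.

Definition prime_difference_graph (n : nat) : rel 'I_n :=
  [rel u v : 'I_n | prime `|vertex_label u - vertex_label v|%N].

Lemma prime_difference_graph_sym n : symmetric (@prime_difference_graph n).
Proof. move=> u v; congr prime; exact: distnC. Qed.

Lemma prime_difference_graph_irr n : irreflexive (@prime_difference_graph n).
Proof. by move=> u; rewrite -[LHS]/(prime `|vertex_label u - vertex_label u|) distnn. Qed.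

(* Main.v *)
Require Import Defs.
From mathcomp Require Import all_boot all_algebra zify.
Set Implicit Arguments.
Unset Strict Implicit.
Unset Printing Implicit Defensive.

(** If n = p + q with p and q distinct primes, then the translation v |-> v + p
    of Z/n moves every vertex of {1, ..., n} by exactly +p or by exactly -q, so
    each of its steps is an edge of G_n; since p is coprime to n, its orbits are
    all of Z/n and one of them is a Hamilton cycle ([two_difference_hamilton]).
    All edges of this cycle join vertices at distance p or q. Two different
    representations n = p + q = p' + q' with p < q and p' < q' have
    {p, q} disjoint from {p', q'}, so their cycles share no edge
    ([cycle_edges_disjoint]).

    It is thus enough to find an n with more than t representations as a sum of
    two distinct primes ([many_prime_partitions]). This is a pigeonhole
    argument: if a is the number of primes up to x, there are about a^2 / 2
    pairs of primes p < q <= x, whose sums take at most 2x + 1 values, so what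
    is needed is that a^2 / x is unbounded. Chebyshev's lower bound gives it:
    every prime power in the factorization of 'C(2m, m) is at most 2m, whence
    2^m <= 'C(2m, m) <= (2m)^a with x = 2m ([bin_le_exp_primes]). For m = 2^k
    this reads 2^k <= (k + 1) a ([prime_count_pow2]), so a^2 / x grows at least
    like 2^k / k^2. *)

(** * Hamilton cycles from translations of Z/n *)

Lemma val_iter_ordS n k (v : 'I_n) : val (iter k (@ordS n) v) = (v + k) %% n.
Proof.
elim: k => [|k IHk] /=; first by rewrite addn0 modn_small.
by rewrite IHk -addn1 modnDml addn1 addnS.
Qed.

Lemma dist_iter_ordS n d (v : 'I_n) : d < n ->
  (`|vertex_label v - vertex_label (iter d (@ordS n) v)|%N \in [:: d; n - d]).
Proof.
move=> lt_dn; rewrite /vertex_label val_iter_ordS !inE.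
have lt_vn := ltn_ord v.
case: (ltnP (v + d) n) => [lt_vdn | le_nvd].
  by rewrite modn_small //; lia.
by rewrite -(subnK le_nvd) modnDr modn_small; lia.
Qed.

(** A translation by a unit of Z/n is transitive: a Bezout coefficient [a] of
    [d], here with [a * d = -1] modulo [n], tells how often to translate. *)
Lemma iter_ordS_fconnect n d (u v : 'I_n) : coprime n d ->
  fconnect (iter d (@ordS n)) u v.
Proof.
move=> co_nd; have lt_vn := ltn_ord v; have n_gt0 : 0 < n by lia.
have [a _] := Bezoutl d n_gt0; rewrite (eqP co_nd) => dvd_n.
pose k := a * (u + (n - v)).
suff -> : v = iter k (iter d (@ordS n)) u by exact: fconnect_iter.
apply: val_inj; rewrite -iterM val_iter_ordS /=.
(* Modulo n, k * d = - (u + (n - v)) = v - u. The extra n on both sides avoids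
   truncated subtraction. *)
have E : u + k * d + n = (1 + a * d) * (u + (n - v)) + v by rewrite /k; nia.
have dvd_nM : n %| (1 + a * d) * (u + (n - v)) by rewrite dvdn_mulr.
by rewrite -(modnDr (u + _)) E -modnDml (eqP dvd_nM) add0n modn_small.
Qed.

(** The cycle is an orbit of the translation by [d]: a step that wraps around
    goes down by [n - d], any other goes up by [d]. *)
Lemma two_difference_hamilton n d : 2 < n -> d < n -> coprime n d ->
  exists c : seq 'I_n,
    hamilton_cycle [rel u v : 'I_n |
      `|vertex_label u - vertex_label v|%N \in [:: d; n - d]] c.
Proof.
move=> n_gt2 lt_dn co_nd; set e := (X in hamilton_cycle X).
pose f := iter d (@ordS n); pose x0 : 'I_n := Ordinal (ltnW (ltnW n_gt2)).
have f_inj : injective f by rewrite /f; elim: (d) => // k IHk x y /ordS_inj/IHk.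
have all_c x : x \in orbit f x0.
  by rewrite -fconnect_orbit iter_ordS_fconnect.
exists (orbit f x0); apply/and3P; split; last by apply/forallP.
  by rewrite -(card_uniqP (orbit_uniq f x0)) (eq_card (B := 'I_n)) ?card_ord.
rewrite /ucycleb orbit_uniq andbT; apply: sub_cycle (cycle_orbit f_inj x0).
by move=> u v /eqP <-; apply: dist_iter_ordS.
Qed.

(** Edges are unordered pairs while the relations are on ordered ones, so the
    symmetry of one relation absorbs the case where the two cycles run through
    a common edge in opposite directions. *)
Lemma cycle_edges_disjoint (T : finType) (e1 e2 : rel T) (c1 c2 : seq T) :
    symmetric e2 -> (forall x y, e1 x y -> ~~ e2 x y) ->
    cycle e1 c1 -> cycle e2 c2 ->
  [disjoint cycle_edges c1 & cycle_edges c2].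
Proof.
move=> sym_e2 e1N2 cyc1 cyc2; apply/pred0P => s; apply/negP => /andP[].
move=> /imsetP[x /(next_cycle cyc1) e1x ->] /imsetP[y /(next_cycle cyc2) e2y].
move: (next _ _) (next _ _) e1x e2y => y' x' /e1N2/negP e2Nx e2y eq_xy.
apply: e2Nx.
have: x \in [set y; y'] by rewrite -eq_xy set21.
have: x' \in [set y; y'] by rewrite -eq_xy set22.
have: y \in [set x; x'] by rewrite eq_xy set21.
have: y' \in [set x; x'] by rewrite eq_xy set22.
rewrite !in_set2.
by do 4![case/orP => /eqP ?]; subst=> //; rewrite 1?sym_e2.
Qed.

(** * Chebyshev's lower bound on the number of primes *)

(** Legendre's formula with a range independent of [n], so that the formulas
    for the three factorials of a binomial coefficient can be added termwise. *)
Lemma widen_logn_fact p n N : prime p -> n <= N ->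
  logn p n`! = \sum_(1 <= k < N.+1) n %/ p ^ k.
Proof.
move=> p_pr le_nN; rewrite logn_fact // [RHS](@big_cat_nat _ _ _ n.+1) //=.
rewrite [X in _ = _ + X]big_nat [X in _ + X]big1 ?addn0 // => k /andP[lt_nk _].
by rewrite divn_small // (leq_trans lt_nk) // ltnW // ltn_expl // prime_gt1.
Qed.

Lemma sum_leq_minn n L : \sum_(1 <= k < n.+1) (k <= L) = minn n L.
Proof.
elim: n => [|n IHn]; first by rewrite big_geq ?min0n.
by rewrite big_nat_recr //= IHn; case: leqP; lia.
Qed.

(** Kummer's bound: termwise in Legendre's formula, [n %/ p ^ k] exceeds
    [m %/ p ^ k + (n - m) %/ p ^ k] by at most one, and by zero as soon as
    [n < p ^ k]; hence there is at most one unit for each power of [p] up to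
    [n]. *)
Lemma logn_bin_le p n m : prime p -> m <= n ->
  logn p 'C(n, m) <= trunc_log p n.
Proof.
move=> p_pr le_mn; have p_gt1 := prime_gt1 p_pr; set L := trunc_log p n.
have := congr1 (logn p) (bin_fact le_mn).
rewrite !lognM ?muln_gt0 ?fact_gt0 ?bin_gt0 //.
rewrite !(@widen_logn_fact p _ n) ?leq_subr // => E.
suff : \sum_(1 <= k < n.+1) n %/ p ^ k <=
   L + (\sum_(1 <= k < n.+1) m %/ p ^ k + \sum_(1 <= k < n.+1) (n - m) %/ p ^ k).
  by rewrite -E leq_add2r.
have leL : \sum_(1 <= k < n.+1) (k <= L) <= L by rewrite sum_leq_minn geq_minr.
apply: leq_trans (leq_add leL (leqnn _)).
rewrite -!big_split /=; apply: leq_sum => k _.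
have q_gt0 : 0 < p ^ k by rewrite expn_gt0 ltnW.
have leL_pow : (p ^ k <= n) <= (k <= L).
  by case: (leqP _ n) => // /trunc_log_max->.
apply: leq_trans (leq_add leL_pow (leqnn _)).
rewrite -{1}(subnKC le_mn) divnD // addnC leq_add2r.
case: (leqP _ n) => [_ | lt_n_pk]; first exact: leq_b1.
rewrite leqNgt lt0b -ltnNge (leq_ltn_trans _ lt_n_pk) //.
by rewrite -[leqRHS](subnKC le_mn) leq_add ?leq_mod.
Qed.

(** The binomial coefficient is the product over the primes [p <= n] of its
    [p]-parts, and each of them is at most [n] by [logn_bin_le]. *)
Lemma bin_le_exp_primes n m : 0 < n -> m <= n ->
  'C(n, m) <= n ^ #|[set p : 'I_n.+1 | prime p]|.
Proof.
move=> n_gt0 le_mn; set B := 'C(n, m).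
have B_gt0 : 0 < B by rewrite bin_gt0.
(* The factorization ranges over p <= n + B, which contains both the range
   p <= B of the definition and the range p <= n to which it is then cut. *)
rewrite -{1}(partnT B_gt0) (@widen_partn (n + B)) ?leq_addl //.
rewrite (@big_cat_nat _ _ _ n.+1) ?ltnS ?leq_addr //=.
rewrite [X in _ * X]big_nat_cond [X in _ * X]big1 ?muln1; last first.
  move=> p /andP[/andP[lt_np _] _].
  case p_pr: (prime p); last by rewrite lognE p_pr.
  have := logn_bin_le p_pr le_mn.
  have /eqP -> : trunc_log p n == 0 by rewrite trunc_log_eq0; lia.
  by rewrite leqn0 => /eqP->.
rewrite big_mkord -sum1_card; rewrite big_mkcond /=.
rewrite (big_morph _ (expnD n) (expn0 n)) [X in _ <= X]big_mkcond /=.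
apply: leq_prod => p _; rewrite inE; case p_pr: (prime p); last by rewrite lognE p_pr.
rewrite expn1 (leq_trans _ (trunc_logP (prime_gt1 p_pr) n_gt0)) //.
by rewrite leq_exp2l ?prime_gt1 // logn_bin_le.
Qed.

(** By Vandermonde, ['C(m + m, m)] is the sum of the squares of the ['C(m, i)],
    which dominates their sum. *)
Lemma exp2_le_central_bin m : 2 ^ m <= 'C(m + m, m).
Proof.
rewrite -binomial.Vandermonde -[2]/(1 + 1) expnDn; apply: leq_sum => i _.
have le_im := leq_ord i.
by rewrite !exp1n !muln1 bin_sub // leq_pmulr // bin_gt0.
Qed.

(** Chebyshev's bound at powers of two, where comparing the exponents of 2 in
    [2 ^ (2 ^ k) <= (2 ^ k.+1) ^ a] takes the place of logarithms. *)
Lemma prime_count_pow2 k :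
  2 ^ k <= k.+1 * #|[set p : 'I_(2 ^ k.+1).+1 | prime p]|.
Proof.
rewrite -(@leq_exp2l 2) // expnM.
apply: leq_trans (exp2_le_central_bin _) _.
rewrite addnn -mul2n -expnS; apply: bin_le_exp_primes.
  by rewrite expn_gt0.
by rewrite leq_exp2l.
Qed.

(** * Numbers with many representations as a sum of two primes *)

Lemma cube_le_exp2 n : (n + 10) ^ 3 <= 2 ^ (n + 10).
Proof.
elim: n => [|n IHn] //; rewrite addSn [2 ^ _]expnS.
apply: leq_trans (_ : 2 * (n + 10) ^ 3 <= _); last by rewrite leq_mul2l IHn.
by rewrite !expnS expn0 !muln1; nia.
Qed.

Lemma pigeonhole (aT rT : finType) (f : aT -> rT) (D : {set aT}) t :
  #|rT| * t < #|D| -> exists y, t < #|[set x in D | f x == y]|.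
Proof.
move=> ltD; apply/existsP; apply: contraLR ltD; rewrite negb_exists -leqNgt.
move=> /forallP le_t; rewrite -sum1_card (partition_big f xpredT) //=.
rewrite -sum_nat_const; apply: leq_sum => y _.
by rewrite leqNgt; apply: contra (le_t y); rewrite sum1dep_card.
Qed.

(** Up to exchanging its components, each pair is increasing or diagonal. *)
Lemma card_lt_pairs n (P : {set 'I_n}) :
  #|P| * #|P| <= 2 * #|[set u in setX P P | u.1 < u.2]| + #|P|.
Proof.
set D := [set u in _ | _]; rewrite -cardsX.
have /subset_leq_card/leq_trans-> // : setX P P \subset
    D :|: [set (u.2, u.1) | u in D] :|: [set (x, x) | x in P].
  apply/subsetP => -[x y] /setXP[Px Py]; rewrite 2!in_setU.
  have [lt_xy | lt_yx | /val_inj <-] := ltngtP x y.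
  - by rewrite inE in_setX Px Py lt_xy.
  - rewrite [X in _ || X || _](_ : _ = true) ?orbT //.
    by apply/imsetP; exists (y, x) => //; rewrite inE in_setX Px Py.
  - by rewrite (imset_f (fun z => (z, z)) Px) orbT.
apply: leq_trans (leq_card_setU _ _) _; rewrite leq_add ?leq_imset_card //.
apply: leq_trans (leq_card_setU _ _) _.
by rewrite mul2n -addnn leq_add2l leq_imset_card.
Qed.

(** With [k = A + 10], one has [A * k ^ 2 < k ^ 3 <= 2 ^ k]. *)
Lemma exp2_gt_mul_square A : exists2 k, 0 < k & A * (k * k) < 2 ^ k.
Proof.
exists (A + 10); first by rewrite addn_gt0 orbT.
by apply: (leq_trans _ (cube_le_exp2 A)); rewrite !expnS expn0; nia.
Qed.

(** The counting behind the pigeonhole: [y] stands for [2 ^ k], [K] for [k + 1],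
    [a] for the number of primes up to [2 * y] and [d] for the number of pairs
    [p < q] of such primes. If [d] were at most [(4 * y + 1) * t <= 5 * K * a * t], then
    [a * a <= 2 * d + a] would force [a <= 10 * K * t + 1], whereas
    [y <= K * a] and the lower bound on [y] give [a > 10 * K * (t + 1)]. *)
Lemma pair_count_bound K y a d t : 0 < K -> 20 * t.+1 * (K * K) < 2 * y ->
  y <= K * a -> a * a <= 2 * d + a -> (2 * (2 * y)).+1 * t < d.
Proof.
move=> K_gt0 lt_y le_y le_d.
have lt_a : 10 * t.+1 * K < a by rewrite -(ltn_pmul2l K_gt0); nia.
rewrite ltnNge; apply/negP => le_dt.
have le_yt : y * t <= K * a * t by rewrite leq_mul2r le_y orbT.
have lt_aa : (10 * t.+1 * K) * a < a * a by rewrite ltn_pmul2r //; lia.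
nia.
Qed.

(** Each entry [p] of [s] stands for the representation of [n] as the sum of
    [p] and [n - p]; a pair with a given sum is determined by its smaller
    component, so distinct pairs give distinct entries. *)
Lemma many_prime_partitions t :
  exists n, exists s : seq nat, [/\ t < size s, uniq s &
    {in s, forall p, [/\ prime p, prime (n - p) & p < n - p]}].
Proof.
have [[//|k] _ lt_k] := exp2_gt_mul_square (20 * t.+1).
set x := 2 ^ k.+1 in lt_k; pose P := [set p : 'I_x.+1 | prime p].
have le_P : 2 ^ k <= k.+1 * #|P| := prime_count_pow2 k.
pose D := [set u in setX P P | u.1 < u.2].
have le_D : #|P| * #|P| <= 2 * #|D| + #|P| := card_lt_pairs P.
(* The sum of two elements of 'I_x.+1 is at most 2 * x, so inord is exact. *)
pose f (u : 'I_x.+1 * 'I_x.+1) : 'I_(2 * x).+1 := inord (u.1 + u.2).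
have fE u : f u = u.1 + u.2 :> nat.
  by rewrite inordK // ltnS mul2n -addnn leq_add ?leq_ord.
have ltD : #|'I_(2 * x).+1| * t < #|D|.
  rewrite card_ord [X in 2 * X](expnS 2 k); apply: (pair_count_bound _ _ le_P le_D) => //.
  by move: lt_k; rewrite /x expnS.
have [n lt_t] := pigeonhole f ltD; set F := [set u in D | _] in lt_t.
have F_sum u : u \in F -> u.1 + u.2 = n :> nat.
  by rewrite inE -fE => /andP[_ /eqP->].
exists n, [seq val u.1 | u in F]; split=> [||p].
- by rewrite size_map -cardE.
- rewrite map_inj_in_uniq ?enum_uniq // => -[p q] [p' q'].
  rewrite !mem_enum => /F_sum/= Spq /F_sum/= Spq' eq_p.
  by congr pair; apply: val_inj => //=; lia.
- case/mapP => u; rewrite mem_enum => uF ->; move/F_sum: (uF) => Su.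
  rewrite -Su addKn; move: uF; rewrite !inE.
  by case/andP => /andP[/andP[-> ->] ->].
Qed.

Theorem corollary4p7 (t : nat) :
  exists2 n : nat, 0 < n &
    exists C : 'I_t -> seq 'I_n,
      (forall i : 'I_t, hamilton_cycle (@prime_difference_graph n) (C i)) /\
      (forall i j : 'I_t, i != j ->
         [disjoint cycle_edges (C i) & cycle_edges (C j)]).
Proof.
have [n [s [lt_ts uniq_s s_prime]]] := many_prime_partitions t.
pose p (i : 'I_t) := nth 0 s i.
have lt_is (i : 'I_t) : i < size s by exact: ltn_trans (ltn_ord i) lt_ts.
have pP i : [/\ prime (p i), prime (n - p i) & p i < n - p i].
  by apply: s_prime; apply: mem_nth.
(* The size of s exceeds t, so s has a first entry even if t = 0. *)
have n_gt2 : 2 < n.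
  have [] := s_prime _ (mem_nth 0 (leq_trans (ltn0Sn t) lt_ts)).
  by move=> /prime_gt1 ? _ ?; lia.
pose e i := [rel u v : 'I_n |
  `|vertex_label u - vertex_label v|%N \in [:: p i; n - p i]].
have /fin_all_exists [C hamC] i : exists c, hamilton_cycle (e i) c.
  have [p_pr q_pr lt_pq] := pP i.
  have le_pn : p i <= n by lia.
  apply: two_difference_hamilton => //; first by have := prime_gt0 p_pr; lia.
  (* p is coprime to p + q, since p and q are distinct primes. *)
  rewrite coprime_sym -(subnKC le_pn) /coprime gcdnDl -/(coprime _ _) prime_coprime //.
  by rewrite dvdn_prime2 // neq_ltn lt_pq.
exists n; first exact: ltn_trans n_gt2.
exists C; split=> [i | i j neq_ij].
  have [p_pr q_pr _] := pP i.
  case/and3P: (hamC i) => C_gt2 /andP[cycC uniqC] allC.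
  rewrite /hamilton_cycle C_gt2 allC andbT /ucycleb uniqC andbT /=.
  apply: sub_cycle cycC => u v; rewrite /e /= !inE.
  by rewrite /prime_difference_graph /=; case/orP => /eqP ->.
case/and3P: (hamC i) => _ /andP[cyci _] _; case/and3P: (hamC j) => _ /andP[cycj _] _.
apply: (@cycle_edges_disjoint _ (e i) (e j)) cyci cycj.
  by move=> u v; rewrite /e /= distnC.
move=> u v; rewrite /e /= !inE => dist_i; apply: contra neq_ij => dist_j.
have [_ _ lt_i] := pP i; have [_ _ lt_j] := pP j.
(* A common distance gives p i = p j or p i = n - p j, and the latter
   contradicts p i < n - p i and p j < n - p j. *)
have : p i == p j by lia.
by rewrite nth_uniq.
Qed.
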